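(* Let $\mathrm{CS}$ be an arbitrary constant specification for $\mathsf{JTO}$. Define $$\mathtt{contract}:=\boxdot(\mathtt{winfirst}_e\leftrightarrow[\mathtt a]^{\mathcal O}_e\mathtt{pay}),$$ $$\mathtt{court}:=\mathtt{true}_{10}\big[(\neg\mathtt{win}_p\leftrightarrow\mathtt{winfirst}_e)\wedge(\mathtt{win}_p\to[\mathtt v_p]^{\mathcal O}_e\mathtt{pay})\wedge(\neg\mathtt{win}_p\to\neg[\mathtt v_e]^{\mathcal O}_e\mathtt{pay})\big].$$ Then the set $\{\mathtt{contract},\ \mathtt{court},\ \mathtt{time}=10\}$ is consistent in $\mathsf{JTO}_{\mathrm{CS}}$, i.e. $\mathtt{contract},\mathtt{court},\mathtt{time}=10\not\vdash_{\mathrm{CS}}\bot$.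
   Context: **Language.** The set of agents is $\mathrm{Ag}=\{p,e,j\}$ (Protagoras, Euathlus, judge); $\mathrm{Const},\mathrm{Var},\mathrm{Prop}$ are countable sets of justification constants, justification variables and atomic propositions. $\mathrm{Prop}$ contains distinct atoms $\mathtt{win}_p$, $\mathtt{winfirst}_e$, $\mathtt{pay}$, and $\mathrm{Var}$ contains distinct variables $\mathtt a$ (the agreement), $\mathtt v_p$, $\mathtt v_e$ (the judge's verdict in favor of Protagoras, resp. Euathlus). Epistemic terms: $t::=c\mid x\mid {!t}\mid t+t\mid t\cdot t$. Normative terms: $s::=c\mid x\mid \ddagger s\mid s\cdot s$ ($c\in\mathrm{Const}$, $x\in\mathrm{Var}$). Formulas: $\varphi::=q\mid\bot\mid\varphi\to\varphi\mid\bigcirc\varphi\mid\mathsf Y_w\varphi\mid\varphi\,\mathcal U\,\varphi\mid\varphi\,\mathcal S\,\varphi\mid[t]_i\varphi\mid[s]^{\mathcal O}_i\varphi$ ($q\in\mathrm{Prop}$, $i\in\mathrm{Ag}$, $t$ epistemic, $s$ normative). Abbreviations: $\neg\varphi:=\varphi\to\bot$, $\top:=\neg\bot$, $\varphi\vee\psi:=\neg\varphi\to\psi$, $\varphi\wedge\psi:=\neg(\neg\varphi\vee\neg\psi)$, $\leftrightarrow$ as usual, $\mathsf Y_s\varphi:=\neg\mathsf Y_w\neg\varphi$, $\Diamond\varphi:=\top\,\mathcal U\,\varphi$, $\Box\varphi:=\neg\Diamond\neg\varphi$, $\blacksquare\varphi:=\neg(\top\,\mathcal S\,\neg\varphi)$,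 $\boxdot\varphi:=\blacksquare\varphi\wedge\Box\varphi$, $\langle s\rangle^{\mathcal P}_i\varphi:=\neg[s]^{\mathcal O}_i\neg\varphi$; for $m\in\mathbb N$, $(\mathtt{time}=m):=\mathsf Y_s^m\mathsf Y_w\bot$ ($m$-fold $\mathsf Y_s$) and $\mathtt{true}_m(\varphi):=\boxdot(\mathtt{time}=m\to\varphi)$. **Axioms** (all instances, all $i\in\mathrm{Ag}$): propositional tautologies; $\ast(\varphi\to\psi)\to(\ast\varphi\to\ast\psi)$ for $\ast\in\{\bigcirc,\Box,\blacksquare,\mathsf Y_w\}$; $\bigcirc\neg\varphi\leftrightarrow\neg\bigcirc\varphi$; $\Box(\varphi\to\bigcirc\varphi)\to(\varphi\to\Box\varphi)$; $\varphi\,\mathcal U\,\psi\to\Diamond\psi$; $\varphi\,\mathcal U\,\psi\leftrightarrow\psi\vee(\varphi\wedge\bigcirc(\varphi\,\mathcal U\,\psi))$; $\mathsf Y_s\varphi\to\mathsf Y_w\varphi$; $\top\,\mathcal S\,\mathsf Y_w\bot$; $\blacksquare(\varphi\to\mathsf Y_w\varphi)\to(\varphi\to\blacksquare\varphi)$; $(\varphi\,\mathcal S\,\psi)\to(\top\,\mathcal S\,\psi)$; $\varphi\,\mathcal S\,\psi\leftrightarrow\psi\vee(\varphi\wedge\mathsf Y_s(\varphi\,\mathcal S\,\psi))$; $\varphi\to\bigcirc\mathsf Y_s\varphi$; $\varphi\to\mathsf Y_w\bigcirc\varphi$; $[t]_i(\varphi\to\psi)\to([s]_i\varphi\to[t\cdot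 s]_i\psi)$; $[t]_i\varphi\to[t+s]_i\varphi$; $[s]_i\varphi\to[t+s]_i\varphi$; $[t]_i\varphi\to\varphi$; $[t]_i\varphi\to[!t]_i[t]_i\varphi$; $[t]^{\mathcal O}_i(\varphi\to\psi)\to([s]^{\mathcal O}_i\varphi\to[t\cdot s]^{\mathcal O}_i\psi)$; $[t]^{\mathcal O}_i\varphi\to\langle t\rangle^{\mathcal P}_i\varphi$; $[\ddagger t]^{\mathcal O}_i([t]^{\mathcal O}_i\varphi\to\varphi)$. **Constant specifications.** A constant specification $\mathrm{CS}$ is a set of formulas of the form $[c_n]_{i_n}\cdots[c_1]_{i_1}\varphi$ or $[c_n]^{\mathcal O}_{i_n}\cdots[c_1]^{\mathcal O}_{i_1}\varphi$ with $n\ge1$, $c_k\in\mathrm{Const}$, $i_k\in\mathrm{Ag}$, $\varphi$ an axiom instance, which is downward closed: for $n>1$, if such a formula is in $\mathrm{CS}$, so is the one obtained by deleting its outermost operator. **Derivability.** $\vdash_{\mathrm{CS}}$ is derivability in the Hilbert system $\mathsf{JTO}_{\mathrm{CS}}$ with these axioms, modus ponens, necessitation (from $\vdash\varphi$ infer $\vdash\ast\varphi$) for $\ast\in\{\bigcirc,\mathsf Y_w,\Box,\blacksquare\}$, and: infer $\vdash\varphi$ for each $\varphi\in\mathrm{CS}$. $T\vdash_{\mathrm{CS}}\varphi$ means $\vdash_{\mathrm{CS}}(\psi_1\wedge\dots\wedge\psi_k)\to\varphi$ for some $\psi_1,\dots,\psi_k\in T$. *)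

(* Defs.v *)
From Stdlib Require List.
From mathcomp Require Import all_boot classical_sets.

Set Implicit Arguments.
Unset Strict Implicit.
Unset Printing Implicit Defensive.

Inductive agent := protagoras | euathlus | judge.

Inductive eterm (Const Var : Type) :=
| EConst (c : Const)
| EVar (x : Var)
| EBang (t : eterm Const Var)
| ESum (t s : eterm Const Var)
| EApp (t s : eterm Const Var).

Inductive nterm (Const Var : Type) :=
| NConst (c : Const)
| NVar (x : Var)
| NDag (s : nterm Const Var)
| NApp (t s : nterm Const Var).

Arguments EConst {Const Var} c.
Arguments EVar {Const Var} x.
Arguments NConst {Const Var} c.
Arguments NVar {Const Var} x.

(* [WYest] is the weak previous operator Y_w; [Know t i A] is [t]_i A and
   [Obl s i A] is [s]^O_i A. *)
Inductive formula (Const Var Atom : Type) :=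
| Atm (q : Atom)
| Bot
| Imp (A B : formula Const Var Atom)
| Next (A : formula Const Var Atom)
| WYest (A : formula Const Var Atom)
| Until (A B : formula Const Var Atom)
| Since (A B : formula Const Var Atom)
| Know (t : eterm Const Var) (i : agent) (A : formula Const Var Atom)
| Obl (s : nterm Const Var) (i : agent) (A : formula Const Var Atom).

Arguments Atm {Const Var Atom} q.
Arguments Bot {Const Var Atom}.

Declare Scope jto_scope.
Delimit Scope jto_scope with jto.
Bind Scope jto_scope with formula.
Local Open Scope jto_scope.

Notation "A ~> B" := (Imp A B) (at level 90, right associativity) : jto_scope.

Section Abbreviations.
Context {Const Var Atom : Type}.
Implicit Types A B : formula Const Var Atom.

Definition Neg A := A ~> Bot.
Definition Top : formula Const Var Atom := Neg Bot.
Definition Or A B := Neg A ~> B.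
Definition And A B := Neg (Or (Neg A) (Neg B)).
Definition Iff A B := And (A ~> B) (B ~> A).
Definition SYest A := Neg (WYest (Neg A)).
Definition Eventually A := Until Top A.
Definition Always A := Neg (Eventually (Neg A)).
Definition Once A := Since Top A.
Definition Hist A := Neg (Once (Neg A)).
Definition AllTime A := And (Hist A) (Always A).
Definition Perm (s : nterm Const Var) (i : agent) A := Neg (Obl s i (Neg A)).

Definition time_eq (m : nat) : formula Const Var Atom :=
  iter m SYest (WYest Bot).
Definition true_at (m : nat) A := AllTime (time_eq m ~> A).

End Abbreviations.

Notation "A <~> B" := (Iff A B) (at level 95, no associativity) : jto_scope.

Section ProofSystem.
Context {Const Var Atom : Type}.
Notation formula := (formula Const Var Atom).
Notation eterm := (eterm Const Var).
Notation nterm := (nterm Const Var).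
Implicit Types (A B : formula) (i : agent).

(* Every formula that is neither [Bot] nor an implication is treated as a
   propositional letter, so [tautology] covers all substitution instances of
   classical tautologies. *)
Fixpoint prop_eval (v : formula -> bool) A : bool :=
  match A with
  | Bot => false
  | A1 ~> A2 => prop_eval v A1 ==> prop_eval v A2
  | _ => v A
  end.

Definition tautology A := forall v : formula -> bool, prop_eval v A.

Inductive jto_axiom : formula -> Prop :=
| ax_taut A : tautology A -> jto_axiom A
| ax_next_K A B : jto_axiom (Next (A ~> B) ~> (Next A ~> Next B))
| ax_always_K A B : jto_axiom (Always (A ~> B) ~> (Always A ~> Always B))
| ax_hist_K A B : jto_axiom (Hist (A ~> B) ~> (Hist A ~> Hist B))
| ax_wyest_K A B : jto_axiom (WYest (A ~> B) ~> (WYest A ~> WYest B))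
| ax_next_fun A : jto_axiom (Next (Neg A) <~> Neg (Next A))
| ax_always_ind A : jto_axiom (Always (A ~> Next A) ~> (A ~> Always A))
| ax_until_eventually A B : jto_axiom (Until A B ~> Eventually B)
| ax_until_unfold A B :
    jto_axiom (Until A B <~> Or B (And A (Next (Until A B))))
| ax_yest_sw A : jto_axiom (SYest A ~> WYest A)
| ax_initial : jto_axiom (Since Top (WYest Bot))
| ax_hist_ind A : jto_axiom (Hist (A ~> WYest A) ~> (A ~> Hist A))
| ax_since_once A B : jto_axiom (Since A B ~> Since Top B)
| ax_since_unfold A B :
    jto_axiom (Since A B <~> Or B (And A (SYest (Since A B))))
| ax_next_yest A : jto_axiom (A ~> Next (SYest A))
| ax_yest_next A : jto_axiom (A ~> WYest (Next A))
| ax_know_app (t s : eterm) i A B :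
    jto_axiom (Know t i (A ~> B) ~> (Know s i A ~> Know (EApp t s) i B))
| ax_know_suml (t s : eterm) i A : jto_axiom (Know t i A ~> Know (ESum t s) i A)
| ax_know_sumr (t s : eterm) i A : jto_axiom (Know s i A ~> Know (ESum t s) i A)
| ax_know_fact (t : eterm) i A : jto_axiom (Know t i A ~> A)
| ax_know_intro (t : eterm) i A :
    jto_axiom (Know t i A ~> Know (EBang t) i (Know t i A))
| ax_obl_app (t s : nterm) i A B :
    jto_axiom (Obl t i (A ~> B) ~> (Obl s i A ~> Obl (NApp t s) i B))
| ax_obl_perm (t : nterm) i A : jto_axiom (Obl t i A ~> Perm t i A)
| ax_obl_dag (t : nterm) i A : jto_axiom (Obl (NDag t) i (Obl t i A ~> A)).

(* The head of the sequence is the outermost operator. *)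
Definition knows (s : seq (Const * agent)) A : formula :=
  foldr (fun ci B => Know (EConst ci.1) ci.2 B) A s.
Definition obls (s : seq (Const * agent)) A : formula :=
  foldr (fun ci B => Obl (NConst ci.1) ci.2 B) A s.

Definition constant_specification (CS : set formula) : Prop :=
  [/\ (forall A, CS A ->
         exists s B, [/\ 0 < size s, jto_axiom B & A = knows s B \/ A = obls s B]),
      (forall ci s B, 0 < size s -> jto_axiom B ->
         CS (knows (ci :: s) B) -> CS (knows s B))
    & (forall ci s B, 0 < size s -> jto_axiom B ->
         CS (obls (ci :: s) B) -> CS (obls s B))].

Inductive provable (CS : set formula) : formula -> Prop :=
| pr_axiom A : jto_axiom A -> provable CS A
| pr_mp A B : provable CS (A ~> B) -> provable CS A -> provable CS B
| pr_nec_next A : provable CS A -> provable CS (Next A)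
| pr_nec_wyest A : provable CS A -> provable CS (WYest A)
| pr_nec_always A : provable CS A -> provable CS (Always A)
| pr_nec_hist A : provable CS A -> provable CS (Hist A)
| pr_cs A : CS A -> provable CS A.

Fixpoint conjs (s : seq formula) : formula :=
  match s with
  | [::] => Top
  | [:: A] => A
  | A :: s' => And A (conjs s')
  end.

Definition derivable (CS T : set formula) A : Prop :=
  exists s : seq formula,
    List.Forall T s /\ provable CS (conjs s ~> A).

Definition consistent (CS T : set formula) : Prop := ~ derivable CS T Bot.

End ProofSystem.

Section Protagoras.
Context {Const Var Atom : Type}.

Definition contract (winfirst_e pay : Atom) (a : Var) :
    formula Const Var Atom :=
  AllTime (Atm winfirst_e <~> Obl (NVar a) euathlus (Atm pay)).

Definition court (win_p winfirst_e pay : Atom) (v_p v_e : Var) :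
    formula Const Var Atom :=
  true_at 10
    (And (And (Neg (Atm win_p) <~> Atm winfirst_e)
              (Atm win_p ~> Obl (NVar v_p) euathlus (Atm pay)))
         (Neg (Atm win_p) ~> Neg (Obl (NVar v_e) euathlus (Atm pay)))).

End Protagoras.

(* Main.v *)
(** Formulas are interpreted on the time line [nat], with the usual clauses for
the temporal operators. Both justification operators are read as truth, except
that an obligation also needs its term to be in force: [[t]_i A] means [A], and
[[s]^O_i A] means that [s] is in force and [A]. Constants and the terms
[NDag s] are always in force, applications are when both components are, and
the status of the variables is arbitrary. This reading validates every axiom,
hence every constant specification. The three formulas then hold at time 10 when
Protagoras never wins, every other atom is always true, and [v_e] is the only
variable not in force. *)
Require Import Defs.
From mathcomp Require Import all_boot classical_sets boolp zify.

Local Open Scope classical_set_scope.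

Section Semantics.
Context {Const Var Atom : Type} (V : Atom -> Prop) (E : Var -> Prop).
Notation formula := (formula Const Var Atom).
Notation nterm := (nterm Const Var).
Implicit Types (A B : formula) (CS : set formula) (n : nat).

(** Constants have to be in force because a constant specification may assert obligations under
    them, and [NDag t] because [ax_obl_dag] asserts one for every [t]. *)
Fixpoint in_force (s : nterm) : Prop :=
  match s with
  | NConst _ => True
  | NVar x => E x
  | NDag _ => True
  | NApp t s => in_force t /\ in_force s
  end.

Fixpoint sat A n : Prop :=
  match A with
  | Atm q => V q
  | Bot => False
  | Imp A B => sat A n -> sat B n
  | Next A => sat A n.+1
  | WYest A => if n is m.+1 then sat A m else True
  | Until A B =>
      exists m, [/\ n <= m, sat B m & forall k, n <= k < m -> sat A k]
  | Since A B =>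
      exists m, [/\ m <= n, sat B m & forall k, m < k <= n -> sat A k]
  | Know _ _ A => sat A n
  | Obl s _ A => in_force s /\ sat A n
  end.

Lemma sat_neg A n : sat (Neg A) n = ~ sat A n.
Proof. by []. Qed.

Lemma sat_imp A B n : sat (Imp A B) n = (sat A n -> sat B n).
Proof. by []. Qed.

Lemma sat_or A B n : sat (Or A B) n = (sat A n \/ sat B n).
Proof.
rewrite propeqE /=; split; last by case.
by case: (pselect (sat A n)) => [|nA] hAB; [left | right; apply: hAB].
Qed.

Lemma sat_and A B n : sat (And A B) n = (sat A n /\ sat B n).
Proof. by rewrite /And sat_neg sat_or !sat_neg not_orE !notK. Qed.

Lemma sat_iff A B n : sat (Iff A B) n = (sat A n <-> sat B n).
Proof. by rewrite /Iff sat_and propeqE. Qed.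

Lemma sat_syest A n :
  sat (SYest A) n = if n is m.+1 then sat A m else False.
Proof.
rewrite /SYest sat_neg; case: n => [|n] /=; last exact: notK.
by rewrite propeqE; split=> // /(_ I).
Qed.

Lemma sat_always A n : sat (Always A) n = (forall m, n <= m -> sat A m).
Proof.
rewrite propeqE /=; split=> [h m nm | h [m [nm nA _]]]; last exact/nA/h.
by apply: contrapT => nA; apply: h; exists m; split.
Qed.

Lemma sat_hist A n : sat (Hist A) n = (forall m, m <= n -> sat A m).
Proof.
rewrite propeqE /=; split=> [h m mn | h [m [mn nA _]]]; last exact/nA/h.
by apply: contrapT => nA; apply: h; exists m; split.
Qed.

Lemma sat_all_time A n : (forall m, sat A m) -> sat (AllTime A) n.
Proof. by move=> hA; rewrite sat_and sat_hist sat_always; split=> m _. Qed.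

(** [WYest Bot] holds only at time 0, and each [SYest] moves one step back and fails at 0. *)
Lemma sat_time_eq m n : sat (time_eq m) n = (n = m).
Proof.
elim: m n => [|m IH] n; first by rewrite propeqE; case: n.
have -> : time_eq m.+1 = SYest (time_eq m) :> formula by [].
rewrite sat_syest; case: n => [|n]; first by rewrite propeqE.
by rewrite IH propeqE; split=> [->|[]].
Qed.

(** Truth at the instant [n] serves as the Boolean valuation of the letters, temporal and
    justification formulas included; this is what makes tautologies true at every instant. *)
Lemma prop_eval_sat A n : prop_eval (fun B => `[< sat B n >]) A = `[< sat A n >].
Proof.
elim: A => //= [|A -> B ->]; first by rewrite asboolF.
by rewrite asbool_imply.
Qed.

Lemma sat_tautology A n : tautology A -> sat A n.
Proof. by move=> /(_ (fun B => `[< sat B n >])); rewrite prop_eval_sat => /asboolP. Qed.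

(** A witness for [Until] is either [n] itself or later, and in the second case it also serves at
    [n.+1]. *)
Lemma sat_until_unfold A B n :
  sat (Until A B) n <-> sat B n \/ sat A n /\ sat (Until A B) n.+1.
Proof.
split=> [[m [nm Bm Am]] | [Bn | [An [m [nm Bm Am]]]]].
- case: (eqVneq m n) Bm => [-> | n_neq_m] Bm; first by left.
  right; split; first by apply: Am; lia.
  by exists m; split=> // [|k nkm]; [lia | apply: Am; lia].
- by exists n; split=> // k; lia.
- exists m; split=> // [|k nkm]; first by lia.
  by have [->//|n_neq_k] := eqVneq k n; apply: Am; lia.
Qed.

Lemma sat_since_unfold A B n :
  sat (Since A B) n <-> sat B n \/ sat A n /\ sat (SYest (Since A B)) n.
Proof.
rewrite sat_syest; split=> [[m [mn Bm Am]] | [Bn | [An]]].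
- case: (eqVneq m n) Bm => [-> | n_neq_m] Bm; first by left.
  right; split; first by apply: Am; lia.
  (* At time 0 the witness could only be 0 itself, which [n_neq_m] excludes. *)
  case: n mn Am n_neq_m => [|n] mn Am n_neq_m; first by lia.
  by exists m; split=> // [|k mkn]; [lia | apply: Am; lia].
- by exists n; split=> // k; lia.
- case: n An => [//|n] An [m [mn Bm Am]].
  exists m; split=> // [|k mkn]; first by lia.
  by have [->//|n_neq_k] := eqVneq k n.+1; apply: Am; lia.
Qed.

Lemma sat_axiom A n : jto_axiom A -> sat A n.
Proof.
case=> {A}.
- by move=> A; apply: sat_tautology.
- by move=> A B hAB hA; apply: hAB.
- move=> A B; rewrite 2!sat_imp !sat_always => hAB hA m nm.
  exact: hAB (hA _ nm).
- move=> A B; rewrite 2!sat_imp !sat_hist => hAB hA m mn.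
  exact: hAB (hA _ mn).
- by case: n => [|n] A B // hAB hA; apply: hAB.
- by move=> A; rewrite sat_iff.
- move=> A; rewrite 2!sat_imp !sat_always => hA An m.
  elim: m => [|m IH]; first by rewrite leqn0 => /eqP <-.
  rewrite leq_eqVlt ltnS => /orP[/eqP<- // | nm].
  exact: hA (IH nm).
- by move=> A B [m [nm Bm _]]; exists m; split=> // k _; exact: id.
- by move=> A B; rewrite sat_iff sat_or sat_and sat_until_unfold.
- by move=> A; rewrite sat_imp sat_syest; case: n.
- by exists 0; split=> // k _; exact: id.
- move=> A; rewrite 2!sat_imp !sat_hist => hA An m mn.
  (* Backward induction on the distance from [n], with [m] written as [n - (n - m)]. Subtraction is
     truncated, so once 0 is reached the instant no longer changes. *)
  rewrite -(subKn mn); elim: (n - m) => [|k IH]; first by rewrite subn0.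
  have [nk | kn] := leqP n k; first by have -> : n - k.+1 = n - k by lia.
  by have := hA _ (leq_subr k n) IH; have -> : n - k = (n - k.+1).+1 by lia.
- by move=> A B [m [mn Bm _]]; exists m; split=> // k _; exact: id.
- by move=> A B; rewrite sat_iff sat_or sat_and sat_since_unfold.
- by move=> A An; rewrite /sat -/sat sat_syest.
- by case: n => [|n] A.
- by move=> t s i A B hAB hA; apply: hAB.
- by move=> t s i A; exact: id.
- by move=> t s i A; exact: id.
- by move=> t i A; exact: id.
- by move=> t i A; exact: id.
- by move=> t s i A B [ft hAB] [fs hA]; split; [split | apply: hAB].
(* Obligations to [A] and to [Neg A] would make [A] both true and false at [n]. *)
- by move=> t i A [ft An] [_ nA]; apply: nA.
- by move=> t i A; split=> // [[]].
Qed.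

Lemma sat_knows s A n : sat (knows s A) n = sat A n.
Proof. by elim: s. Qed.

Lemma sat_obls s A n : sat (obls s A) n = sat A n.
Proof.
by elim: s => //= ci s IH; rewrite propeqE -IH; split=> [[]|].
Qed.

(** Soundness. The induction keeps the instant general because the necessitation rules pass to other
    instants. *)
Lemma sat_provable CS A n :
  constant_specification CS -> provable CS A -> sat A n.
Proof.
move=> [CS_form _ _] prA; elim: prA n => {A}.
- by move=> A axA n; apply: sat_axiom.
- by move=> A B _ hAB _ hA n; exact: (hAB n (hA n)).
- by move=> A _ hA n; exact: (hA n.+1).
- by move=> A _ hA [|n]; [exact: I | exact: (hA n)].
- by move=> A _ hA n; rewrite sat_always.
- by move=> A _ hA n; rewrite sat_hist.
- move=> A /CS_form[s [B [_ axB [->|->]]]] n;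
    by rewrite ?sat_knows ?sat_obls; apply: sat_axiom.
Qed.

Lemma sat_conjs (s : seq formula) n :
  List.Forall (fun A => sat A n) s -> sat (conjs s) n.
Proof.
elim=> {s} [|A [|B s] An _ IH]; [by [] | by [] |].
by rewrite [conjs _]/= sat_and; split.
Qed.

Lemma sat_consistent CS (T : set formula) n :
  constant_specification CS -> (forall A, T A -> sat A n) -> consistent CS T.
Proof.
move=> hCS satT [s [Ts pr]]; apply: (sat_provable _ _ n hCS pr).
by apply: sat_conjs; apply: List.Forall_impl Ts.
Qed.

End Semantics.

Theorem lemma7p1 (Const Var Atom : countType)
    (win_p winfirst_e pay : Atom) (a v_p v_e : Var)
    (atoms_distinct : uniq [:: win_p; winfirst_e; pay])
    (vars_distinct : uniq [:: a; v_p; v_e])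
    (CS : set (formula Const Var Atom))
    (hCS : constant_specification CS) :
  consistent CS
    [set contract winfirst_e pay a;
         court win_p winfirst_e pay v_p v_e;
         time_eq 10].
Proof.
move: atoms_distinct vars_distinct => /=.
rewrite !inE !negb_or !andbT => /andP[/andP[wp_neq_we wp_neq_pay] _].
move=> /andP[/andP[_ a_neq_ve] _].
(* Since [pay] is true, an obligation to pay depends only on whether its term is in force: [a]
   yields one, matching the truth of [winfirst_e], and [v_e] yields none, as [court] demands when
   [win_p] fails. *)
pose V q := q != win_p; pose E x := x != v_e.
have V_we : V winfirst_e by rewrite /V eq_sym.
have V_pay : V pay by rewrite /V eq_sym.
have not_V_wp : ~ V win_p by rewrite /V eqxx.
have not_E_ve : ~ E v_e by rewrite /E eqxx.
apply: (sat_consistent V E _ _ 10 hCS) => _ [[->|->]|->]; last first.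
- by rewrite (sat_time_eq V E 10 10).
(* The body of [court] holds at every instant, so the premise on the time is dropped. *)
- apply: sat_all_time => m; rewrite sat_imp => _.
  rewrite 2!sat_and sat_iff; split; first by split.
  by move=> _ [].
- by apply: sat_all_time => m; rewrite sat_iff.
Qed.
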